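(* (New noncommutative Spitzer formula) Let $(A,R)$ be an associative (not necessarily commutative) Rota--Baxter algebra of weight $\theta$ over a field $\mathbb{K}$ of characteristic zero, and let $X_1,\dots,X_n\in A$. Then $$\sum_{\sigma\in S_n}R\Bigl(\cdots R\bigl(R(X_{\sigma_1})X_{\sigma_2}\bigr)\cdots X_{\sigma_n}\Bigr)=\sum_{\sigma\in S_n}R\bigl(T_\sigma(X_1,\ldots,X_n)\bigr),$$ $$\sum_{\sigma\in S_n}R\Bigl(X_{\sigma_1}\cdots R\bigl(X_{\sigma_{n-1}}R(X_{\sigma_n})\bigr)\cdots\Bigr)=\sum_{\sigma\in S_n}R\bigl(U_\sigma(X_1,\ldots,X_n)\bigr).$$
   Context: A Rota--Baxter algebra of weight $\theta\in\mathbb{K}$ is an associative $\mathbb{K}$-algebra $A$ with a linear map $R:A\to A$ such that $R(x)R(y)=R\bigl(R(x)y+xR(y)+\theta xy\bigr)$. On $A$ define $$a\ast_\theta b:=R(a)b+aR(b)+\theta ab,\quad a\triangleright_\theta b:=R(a)b-bR(a)-\theta ba,\quad a\triangleleft_\theta b:=aR(b)-R(b)a-\theta ba;$$ $\ast_\theta$ is associative. For $\sigma\in S_n$, written as a sequence $(\sigma_1,\dots,\sigma_n)$, let $E_\sigma=\{k_1<\cdots<k_p\}$ be the set of $k\in\{1,\dots,n-1\}$ such that $\sigma_{k+1}>\sigma_j$ for all $j\le k$. Cut the sequence after each position in $E_\sigma$, giving $p+1$ packets; then $$T_\sigma(a_1,\ldots,a_n):=\Bigl(\cdots(a_{\sigma_1}\triangleright_\theta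 a_{\sigma_2})\triangleright_\theta\cdots\triangleright_\theta a_{\sigma_{k_1}}\Bigr)\ast_\theta\cdots\ast_\theta\Bigl(\cdots(a_{\sigma_{k_p+1}}\triangleright_\theta a_{\sigma_{k_p+2}})\triangleright_\theta\cdots\triangleright_\theta a_{\sigma_n}\Bigr),$$ with parentheses set to the left inside each packet (a packet of one letter is that element itself). Let $F_\sigma=\{l_1<\cdots<l_q\}$ be the set of $l\in\{1,\dots,n-1\}$ such that $\sigma_l<\sigma_j$ for all $j\ge l+1$. Cut the sequence after each position in $F_\sigma$, giving $q+1$ packets; then $$U_\sigma(a_1,\ldots,a_n):=\Bigl(a_{\sigma_1}\triangleleft_\theta(\cdots(a_{\sigma_{l_1-1}}\triangleleft_\theta a_{\sigma_{l_1}})\cdots)\Bigr)\ast_\theta\cdots\ast_\theta\Bigl(a_{\sigma_{l_q+1}}\triangleleft_\theta(\cdots(a_{\sigma_{n-1}}\triangleleft_\theta a_{\sigma_n})\cdots)\Bigr),$$ with parentheses set to the right inside each packet. Example: for $\sigma=(3261457)$, $E_\sigma=\{2,6\}$ and $F_\sigma=\{4,5,6\}$, so $T_\sigma=(a_3\triangleright_\theta a_2)\ast_\theta(((a_6\triangleright_\theta a_1)\triangleright_\theta a_4)\triangleright_\theta a_5)\ast_\theta a_7$ and $U_\sigma=(a_3\triangleleft_\theta(a_2\triangleleft_\theta(a_6\triangleleft_\theta a_1)))\ast_\theta a_4\ast_\theta a_5\ast_\theta a_7$. *)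

(* Defs.v *)
From mathcomp Require Import all_boot all_order all_algebra all_fingroup.
From mathcomp Require Import sesquilinear.

Set Implicit Arguments.
Unset Strict Implicit.
Unset Printing Implicit Defensive.

Import GRing.Theory.
Local Open Scope ring_scope.

(* MathComp's algebras are unital.  Here an associative, possibly nonunital
   K-algebra is an lmodType K with an associative bilinear product [mul]. *)
Definition rota_baxter (K : fieldType) (A : lmodType K)
    (mul : A -> A -> A) (theta : K) (R : A -> A) : Prop :=
  forall x y : A,
    mul (R x) (R y) = R (mul (R x) y + mul x (R y) + theta *: mul x y).

Definition rb_ast (K : fieldType) (A : lmodType K)
    (mul : A -> A -> A) (theta : K) (R : A -> A) (a b : A) : A :=
  mul (R a) b + mul a (R b) + theta *: mul a b.

Definition rb_tright (K : fieldType) (A : lmodType K)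
    (mul : A -> A -> A) (theta : K) (R : A -> A) (a b : A) : A :=
  mul (R a) b - mul b (R a) - theta *: mul b a.

Definition rb_tleft (K : fieldType) (A : lmodType K)
    (mul : A -> A -> A) (theta : K) (R : A -> A) (a b : A) : A :=
  mul a (R b) - mul (R b) a - theta *: mul b a.

(* (..(x1 op x2) op ..) op xm; the value 0 on [::] is never used below *)
Definition nestl (A : nmodType) (op : A -> A -> A) (s : seq A) : A :=
  if s is x :: s' then foldl op x s' else 0.

(* x1 op (.. (x(m-1) op xm)..) *)
Fixpoint nestr (A : nmodType) (op : A -> A -> A) (s : seq A) : A :=
  match s with
  | [::] => 0
  | [:: x] => x
  | x :: s' => op x (nestr op s')
  end.

(* The letters are numbered from 0, which does not affect their comparison.
   A cut k stands for a cut after the first k letters, so that nth 0%N w k is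
   the letter following it and nth 0%N w k.-1 the letter preceding it. *)
Definition word (n : nat) (s : 'S_n) : seq nat := [seq val (s i) | i : 'I_n].

Definition cutsE (w : seq nat) : seq nat :=
  [seq k <- iota 1 (size w).-1 | all (fun x => x < nth 0 w k)%N (take k w)].

Definition cutsF (w : seq nat) : seq nat :=
  [seq l <- iota 1 (size w).-1 | all (fun x => nth 0 w l.-1 < x)%N (drop l w)].

(* The packets of s cut after each of the (increasing) positions in c, which
   have lengths k1, k2 - k1, ..., kp - k(p-1), size s - kp. *)
Definition packets (T : Type) (c : seq nat) (s : seq T) : seq (seq T) :=
  reshape (pairmap (fun k l => l - k)%N 0%N (rcons c (size s))) s.

Example cutsE_3261457 : cutsE [:: 3; 2; 6; 1; 4; 5; 7]%N = [:: 2; 6]%N.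
Proof. by []. Qed.

Example cutsF_3261457 : cutsF [:: 3; 2; 6; 1; 4; 5; 7]%N = [:: 4; 5; 6]%N.
Proof. by []. Qed.

Example packetsE_3261457 :
  packets [:: 2; 6]%N [:: 3; 2; 6; 1; 4; 5; 7]%N
  = [:: [:: 3; 2]; [:: 6; 1; 4; 5]; [:: 7]]%N.
Proof. by []. Qed.

Definition letters (A : Type) (n : nat) (X : 'I_n -> A) (s : 'S_n) : seq A :=
  [seq X (s i) | i : 'I_n].

Definition T_ (K : fieldType) (A : lmodType K)
    (mul : A -> A -> A) (theta : K) (R : A -> A)
    (n : nat) (s : 'S_n) (X : 'I_n -> A) : A :=
  nestl (rb_ast mul theta R)
    [seq nestl (rb_tright mul theta R) p
      | p <- packets (cutsE (word s)) (letters X s)].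

Definition U_ (K : fieldType) (A : lmodType K)
    (mul : A -> A -> A) (theta : K) (R : A -> A)
    (n : nat) (s : 'S_n) (X : 'I_n -> A) : A :=
  nestl (rb_ast mul theta R)
    [seq nestr (rb_tleft mul theta R) p
      | p <- packets (cutsF (word s)) (letters X s)].

(* R(...R(R(X_{s1}) X_{s2})... X_{sn}) *)
Definition spitzer_left (K : fieldType) (A : lmodType K)
    (mul : A -> A -> A) (R : A -> A) (n : nat) (s : 'S_n) (X : 'I_n -> A) : A :=
  R (nestl (fun a x => mul (R a) x) (letters X s)).

(* R(X_{s1} ...R(X_{s(n-1)} R(X_{sn}))...) *)
Definition spitzer_right (K : fieldType) (A : lmodType K)
    (mul : A -> A -> A) (R : A -> A) (n : nat) (s : 'S_n) (X : 'I_n -> A) : A :=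
  R (nestr (fun x a => mul x (R a)) (letters X s)).

(* Main.v *)
(* Put a > b = R(a)b and a < b = aR(b) + theta ab, so that a * b = a > b + a < b
   and a |> b = a > b - b < a.  For a set S of letters let L(S) be the sum of
   (..(x1 > x2) > ..) > xk over the arrangements of S, and P(m,V) the sum of
   (..(m |> v1) |> ..) |> vk over the arrangements of V.  From
     u * (q |> a) = (u * q) > a - (u > a) < q + u < (q |> a)
   an induction on S gives, for any letter m outside S,
     L(S + m) = sum over the subsets U of S of L(U) * P(m, S - U).
   When m is the largest letter, it opens the last packet of a word u m v, so the
   sum of the T_ over the arrangements of S + m satisfies the same recursion.
   The second identity is the first one in the opposite algebra, read on reversed
   words and with m the smallest letter.  Both hold before applying R. *)
Require Import Defs.
From mathcomp Require Import all_boot all_order all_algebra all_fingroup.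
From mathcomp Require Import sesquilinear.

Set Implicit Arguments.
Unset Strict Implicit.
Unset Printing Implicit Defensive.

Import GRing.Theory.
Local Open Scope ring_scope.

(** * Sums over the arrangements of a finite set of letters *)

Section Arrangements.

Variables (I : finType) (A : zmodType).
Implicit Types (S U V : {set I}) (f g : seq I -> A).

(** Summing over duplicate-free words, rather than permutations, lets inductions pass to subsets of
    the letters. *)
Definition arr_sum S f : A := \sum_(w <- permutations (enum S)) f w.

Lemma mem_arr S w :
  (w \in permutations (enum S)) = uniq w && [forall i, (i \in w) == (i \in S)].
Proof.
rewrite mem_permutations; apply/idP/andP=> [pw|[uw /forallP wS]].
  rewrite (perm_uniq pw) enum_uniq; split=> //; apply/forallP=> i.
  by rewrite (perm_mem pw) mem_enum.
apply: uniq_perm; rewrite ?enum_uniq // => i.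
by rewrite mem_enum; apply/eqP.
Qed.

Lemma arr_sum0 f : arr_sum set0 f = f [::].
Proof. by rewrite /arr_sum enum_set0 big_seq1. Qed.

Lemma eq_arr_sum S f g :
    (forall w, uniq w -> w =i S -> f w = g w) -> arr_sum S f = arr_sum S g.
Proof.
move=> fg; rewrite /arr_sum !big_seq; apply: eq_bigr => w.
by rewrite mem_arr => /andP[uw /forallP wS]; apply: fg => // i; apply/eqP.
Qed.

Lemma exchange_arr_sum (D : {pred I}) S (F : I -> seq I -> A) :
  arr_sum S (fun w => \sum_(i in D) F i w) = \sum_(i in D) arr_sum S (F i).
Proof. exact: exchange_big. Qed.

Lemma arr_sum_rcons S f : S != set0 ->
  arr_sum S f = \sum_(i in S) arr_sum (S :\ i) (fun w => f (rcons w i)).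
Proof.
move=> S0; rewrite /arr_sum -[RHS]big_enum /=.
rewrite -[RHS](big_allpairs_dep (h := fun i w => rcons w i)) /=.
apply: perm_big; apply: uniq_perm; first exact: permutations_uniq.
  apply: allpairs_uniq_dep; rewrite ?enum_uniq //.
    by move=> i _; apply: permutations_uniq.
  by move=> [i u] [j v] _ _ /= /eqP; rewrite eqseq_rcons => /andP[/eqP-> /eqP->].
move=> w; apply/idP/allpairsPdep=> [|[i [u [iS uS ->]]]]; last first.
  move: iS uS; rewrite mem_enum !mem_arr rcons_uniq => iS /andP[-> /forallP uS].
  rewrite (eqP (uS i)) !inE eqxx /=; apply/forallP=> j.
  rewrite mem_rcons inE (eqP (uS j)) !inE.
  by case: (eqVneq j i) => [->|_] /=; rewrite ?iS ?eqxx.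
rewrite mem_arr; case/lastP: w => [|u i].
  case/set0Pn: S0 => i iS /andP[_ /forallP/(_ i)].
  by rewrite iS.
rewrite rcons_uniq => /andP[/andP[iu uu] /forallP wS].
exists i, u; split=> //.
  by rewrite mem_enum -(eqP (wS i)) mem_rcons mem_head.
rewrite mem_arr uu; apply/forallP=> j; rewrite !inE -(eqP (wS j)).
by rewrite mem_rcons inE; case: (eqVneq j i) => [->|_] //=; rewrite (negPf iu).
Qed.

Lemma arr_sum_rev S f : arr_sum S f = arr_sum S (f \o rev).
Proof.
rewrite /arr_sum -[RHS](big_map rev xpredT f).
apply: perm_big; apply: uniq_perm; first exact: permutations_uniq.
  by rewrite map_inj_uniq ?permutations_uniq //; apply: (can_inj revK).
move=> w; rewrite -[w in RHS]revK mem_map; last exact: (can_inj revK).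
by rewrite !mem_permutations perm_rev.
Qed.

(** With [exchange_add], this lets a letter pass between [U] and its complement: both double sums
    are indexed by a letter [i] of [S] and a subset of [S :\ i]. *)
Lemma exchange_sub S (F : {set I} -> I -> A) :
  \sum_(U : {set I} | U \subset S) \sum_(i in S :\: U) F U i
  = \sum_(i in S) \sum_(U : {set I} | U \subset S :\ i) F U i.
Proof.
rewrite (exchange_big_dep (mem S)) /=; last by move=> U i _ /setDP[].
apply: eq_bigr => i iS; apply: eq_bigl => U.
by rewrite !inE iS andbT subsetD1.
Qed.

Lemma exchange_add S (F : {set I} -> I -> A) :
  \sum_(U : {set I} | U \subset S) \sum_(i in U) F (U :\ i) i
  = \sum_(i in S) \sum_(U : {set I} | U \subset S :\ i) F U i.
Proof.
rewrite (exchange_big_dep (mem S)) /=; last by move=> U i /subsetP/[apply].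
apply: eq_bigr => i iS.
rewrite (reindex_onto (fun U => i |: U) (fun U => U :\ i)) /=; last first.
  by move=> U /andP[_ iU]; rewrite setD1K.
rewrite [LHS](eq_bigr (F^~ i)) => [|U /andP[_ /eqP->] //].
apply: eq_bigl => U; rewrite setU11 andbT subUset sub1set iS /= subsetD1.
apply: andb_id2l => _; apply/eqP/idP => [<-|/setU1K //].
by rewrite setD11.
Qed.

(** Induction on the size of [S] by removing the last letter. If it is [m], then [U = S] and [v] is
    empty; otherwise it is the last letter of [v]. *)
Lemma arr_sum_setU1 S m f : m \notin S ->
  arr_sum (m |: S) f
  = \sum_(U : {set I} | U \subset S)
      arr_sum U (fun u => arr_sum (S :\: U) (fun v => f (u ++ m :: v))).
Proof.
have [k] := ubnP #|S|; elim: k S f => // k IH S f /ltnSE Sk mS.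
have mS0 : m |: S != set0 by apply/set0Pn; exists m; rewrite setU11.
rewrite arr_sum_rcons // big_setU1 //= setU1K //.
rewrite (bigD1 S) //= setDv; congr (_ + _).
  by apply: eq_arr_sum => u _ _; rewrite arr_sum0 cats1.
under eq_bigr => i iS.
  have im : i != m by apply: contraNneq mS => <-.
  have -> : (m |: S) :\ i = m |: (S :\ i).
    apply/setP=> j; rewrite !inE.
    by case: (eqVneq j m) => // ->; rewrite eq_sym im.
  rewrite IH ?inE ?(negPf mS) ?andbF //; last first.
    by apply: leq_trans Sk; rewrite [#|S|](cardsD1 i) iS.
  over.
rewrite -(exchange_sub S (fun U i => arr_sum U (fun u =>
  arr_sum ((S :\ i) :\: U) (fun v => f (rcons (u ++ m :: v) i))))).
rewrite [LHS](bigD1 S) //= setDv big_set0 add0r.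
apply: eq_bigr => U /andP[US UneS].
rewrite -exchange_arr_sum; apply: eq_arr_sum => u _ _.
(* As [U] differs from [S], the words [v] are nonempty and have a last letter. *)
rewrite arr_sum_rcons; last first.
  by rewrite setD_eq0; apply: contra UneS => SU; rewrite eqEsubset US.
apply: eq_bigr => i _; rewrite setDDl setUC -setDDl.
by apply: eq_arr_sum => v _ _; rewrite rcons_cat.
Qed.

End Arrangements.

(** * The recursion for left-nested sums, from dendriform relations *)

Section Dendriform.

Variables (I : finType) (A : zmodType) (gt lt ast tri : A -> A -> A).
Hypotheses (gtDl : forall b, {morph gt^~ b : x y / x + y})
           (gtDr : forall a, {morph gt a : x y / x + y})
           (ltDl : forall b, {morph lt^~ b : x y / x + y})
           (ltDr : forall a, {morph lt a : x y / x + y}).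
Hypotheses (astE : forall a b, ast a b = gt a b + lt a b)
           (triE : forall a b, tri a b = gt a b - lt b a).
Hypotheses (gt_ast : forall a b c, gt a (gt b c) = gt (ast a b) c)
           (gt_lt : forall a b c, gt a (lt b c) = lt (gt a b) c).
Variable X : I -> A.
Implicit Types (S U V : {set I}) (T : seq I -> A).

Let gt0x b : gt 0 b = 0.
Proof. by apply: (addrI (gt 0 b)); rewrite -gtDl !addr0. Qed.
Let gtx0 a : gt a 0 = 0.
Proof. by apply: (addrI (gt a 0)); rewrite -gtDr !addr0. Qed.
Let lt0x b : lt 0 b = 0.
Proof. by apply: (addrI (lt 0 b)); rewrite -ltDl !addr0. Qed.
Let ltx0 a : lt a 0 = 0.
Proof. by apply: (addrI (lt a 0)); rewrite -ltDr !addr0. Qed.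

Let ast0x b : ast 0 b = 0.
Proof. by rewrite astE gt0x lt0x addr0. Qed.
Let astx0 a : ast a 0 = 0.
Proof. by rewrite astE gtx0 ltx0 addr0. Qed.
Let astDl b : {morph ast^~ b : x y / x + y}.
Proof. by move=> x y; rewrite !astE gtDl ltDl addrACA. Qed.
Let astDr a : {morph ast a : x y / x + y}.
Proof. by move=> x y; rewrite !astE gtDr ltDr addrACA. Qed.
Let tri0x b : tri 0 b = 0.
Proof. by rewrite triE gt0x ltx0 subr0. Qed.
Let triDl b : {morph tri^~ b : x y / x + y}.
Proof. by move=> x y; rewrite !triE gtDl ltDr opprD addrACA. Qed.

Definition left_sum S : A := arr_sum S (fun w => nestl gt (map X w)).

Definition packet_sum m S : A :=
  arr_sum S (fun v => foldl tri (X m) (map X v)).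

(* The product of the sum over the arrangements of U by b, where the empty
   arrangement acts as a unit although [nestl] gives it the junk value 0. *)
Definition umul (op : A -> A -> A) U b : A :=
  op (left_sum U) b + (if U == set0 then b else 0).

Lemma left_sum0 : left_sum set0 = 0.
Proof. by rewrite /left_sum arr_sum0. Qed.

Lemma left_sum_rec S :
  left_sum S = \sum_(i in S) umul gt (S :\ i) (X i).
Proof.
have [->|S0] := eqVneq S set0; first by rewrite left_sum0 big_set0.
rewrite /left_sum arr_sum_rcons //; apply: eq_bigr => i iS.
rewrite /umul; case: eqVneq => [->|Si0].
  by rewrite arr_sum0 left_sum0 /= gt0x add0r.
rewrite addr0 /left_sum /arr_sum.
rewrite (big_morph (gt^~ (X i)) (gtDl (X i)) (gt0x (X i))).
apply: eq_arr_sum => -[|j w] _ wS.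
  by case/set0Pn: Si0 => j; rewrite -wS.
by rewrite /= map_rcons foldl_rcons.
Qed.

Lemma packet_sum0 m : packet_sum m set0 = X m.
Proof. by rewrite /packet_sum arr_sum0. Qed.

Lemma packet_sum_rec m S : S != set0 ->
  packet_sum m S = \sum_(i in S) tri (packet_sum m (S :\ i)) (X i).
Proof.
move=> S0; rewrite /packet_sum arr_sum_rcons //; apply: eq_bigr => i iS.
rewrite /arr_sum (big_morph (tri^~ (X i)) (triDl (X i)) (tri0x (X i))).
by apply: eq_bigr => w _; rewrite map_rcons foldl_rcons.
Qed.

(** For nonempty [U], expand [ast] and [tri], then apply [gt_ast] and [gt_lt] to the two terms of
    the form [gt u _]. For empty [U], this is [triE]. *)
Lemma umul_ast_tri U q a :
  umul ast U (tri q a)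
  = gt (umul ast U q) a - lt (umul gt U a) q + lt (left_sum U) (tri q a).
Proof.
have gtB x y z : gt x (y - z) = gt x y - gt x z.
  by apply: (addIr (gt x z)); rewrite -gtDr !subrK.
rewrite /umul; case: eqVneq => [->|_].
  by rewrite left_sum0 !(ast0x, gt0x, lt0x, add0r, addr0) triE.
by rewrite !addr0 astE {1}triE gtB gt_ast gt_lt.
Qed.

(** Both sides are expanded along their last letter. By [umul_ast_tri] the right side produces the
    [gt] terms of the left side, and its [lt] terms cancel. *)
Lemma left_sum_setU1 S m : m \notin S ->
  left_sum (m |: S)
  = \sum_(U : {set I} | U \subset S) umul ast U (packet_sum m (S :\: U)).
Proof.
have [k] := ubnP #|S|; elim: k S => // k IH S /ltnSE Sk mS.
rewrite left_sum_rec big_setU1 //= setU1K //.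
under eq_bigr => i iS.
  have im : i != m by apply: contraNneq mS => <-.
  have -> : (m |: S) :\ i = m |: (S :\ i).
    apply/setP=> j; rewrite !inE.
    by case: (eqVneq j m) => // ->; rewrite eq_sym im.
  rewrite /umul setU_eq0 -cards_eq0 cards1 /= addr0.
  rewrite IH ?inE ?(negPf mS) ?andbF //; last first.
    by apply: leq_trans Sk; rewrite [#|S|](cardsD1 i) iS.
  rewrite (big_morph (gt^~ (X i)) (gtDl (X i)) (gt0x (X i))).
  over.
rewrite -(exchange_sub S (fun U i =>
  gt (umul ast U (packet_sum m ((S :\ i) :\: U))) (X i))).
pose q U i := packet_sum m (S :\: U :\ i).
pose tris U := \sum_(i in S :\: U) tri (q U i) (X i).
(* At [U = S] the two values differ: the packet is [X m], while [tris S] is an empty sum. That term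
   is treated apart below. *)
have packetE U : U \subset S -> U != S -> packet_sum m (S :\: U) = tris U.
  move=> US UneS; apply: packet_sum_rec; rewrite setD_eq0.
  by apply: contra UneS => SU; rewrite eqEsubset US.
have umul0 U : umul ast U 0 = 0 by rewrite /umul astx0 add0r if_same.
have umulD U : {morph umul ast U : x y / x + y}.
  by move=> x y; rewrite /umul astDr; case: ifP; rewrite ?addr0 // addrACA.
have umulE U : umul ast U (tris U)
  = \sum_(i in S :\: U) gt (umul ast U (q U i)) (X i)
    - \sum_(i in S :\: U) lt (umul gt U (X i)) (q U i)
    + lt (left_sum U) (tris U).
  rewrite (big_morph _ (umulD U) (umul0 U)).
  rewrite (big_morph _ (ltDr (left_sum U)) (ltx0 (left_sum U))).
  rewrite -sumrN -!big_split /=.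
  by apply: eq_bigr => i _; apply: umul_ast_tri.
(* The key cancellation: [umul gt U (X i)] is the part of [left_sum (i |: U)] whose words end in
   [i], so summing over [i] rebuilds the left sum of the larger set. *)
have ltE : \sum_(U : {set I} | U \subset S)
      \sum_(i in S :\: U) lt (umul gt U (X i)) (q U i)
    = \sum_(U : {set I} | U \subset S) lt (left_sum U) (packet_sum m (S :\: U)).
  transitivity (\sum_(U : {set I} | U \subset S) \sum_(i in S :\: U)
      lt (umul gt U (X i)) (packet_sum m (S :\: (i |: U)))).
    by do 2!apply: eq_bigr => ? _; rewrite /q setDDl setUC.
  rewrite exchange_sub -(exchange_add S (fun U i =>
    lt (umul gt U (X i)) (packet_sum m (S :\: (i |: U))))).
  apply: eq_bigr => U _; rewrite left_sum_rec.
  rewrite (big_morph (lt^~ _) (ltDl _) (lt0x _)).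
  by apply: eq_bigr => i iU; rewrite setD1K.
have qE U i : packet_sum m (S :\ i :\: U) = q U i.
  by rewrite /q !setDDl setUC.
rewrite [X in _ + X = _](eq_bigr (fun U : {set I} =>
    \sum_(i in S :\: U) gt (umul ast U (q U i)) (X i))); last first.
  by move=> U _; apply: eq_bigr => i _; rewrite qE.
have trisS : tris S = 0 by rewrite /tris setDv big_set0.
rewrite [RHS](bigD1 S) //= setDv packet_sum0.
rewrite [X in _ = _ + X](eq_bigr (fun U => umul ast U (tris U))); last first.
  by move=> U /andP[US UneS]; rewrite packetE.
have -> : \sum_(U : {set I} | (U \subset S) && (U != S)) umul ast U (tris U)
    = \sum_(U : {set I} | U \subset S) umul ast U (tris U).
  by rewrite [RHS](bigD1 S) //= trisS umul0 add0r.
rewrite (eq_bigr _ (fun U _ => umulE U)) !big_split /= sumrN ltE.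
(* Only the term at [S] of the [lt] sum survives the cancellation; it completes [umul gt S (X m)] to
   [umul ast S (X m)]. *)
rewrite (bigD1 S (P := fun U => U \subset S) (F := fun U => lt _ _)) //=.
rewrite setDv packet_sum0.
rewrite [X in _ + (_ - (_ + X) + _)](eq_bigr (fun U => lt (left_sum U) (tris U)));
  last by move=> U /andP[US UneS]; rewrite packetE.
rewrite [X in _ + (_ + X)](bigD1 S) //= trisS ltx0 add0r.
have -> : umul ast S (X m) = umul gt S (X m) + lt (left_sum S) (X m).
  by rewrite /umul astE addrAC.
rewrite -[RHS]addrA; congr (_ + _).
by rewrite [RHS]addrC -[RHS]addrA [X in _ - _ + X]addrC subrK.
Qed.

(* A word statistic obeying the same recursion as [left_sum_setU1], but only
   when the distinguished letter dominates the others. *)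
Lemma arr_sum_packets (below : rel I) T :
    T [::] = 0 ->
    (forall u m v, all (below^~ m) (u ++ v) ->
       T (u ++ m :: v) =
         if u == [::] then foldl tri (X m) (map X v)
         else ast (T u) (foldl tri (X m) (map X v))) ->
    (forall S, S != set0 ->
       exists2 m, m \in S & forall i, i \in S :\ m -> below i m) ->
  forall S, arr_sum S T = left_sum S.
Proof.
move=> T0 Tcat top S.
have [k] := ubnP #|S|; elim: k S => // k IH S /ltnSE Sk.
have [->|S0] := eqVneq S set0; first by rewrite left_sum0 arr_sum0.
have [m mS mtop] := top S S0.
(* Both sides are now sums over the set [U] of letters preceding the dominant letter [m], and are
   compared term by term. *)
rewrite -(setD1K mS) left_sum_setU1 ?setD11 // arr_sum_setU1 ?setD11 //.
apply: eq_bigr => U USm.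
have Uk : (#|U| < k)%N.
  apply: leq_ltn_trans (subset_leq_card USm) _.
  by apply: leq_trans Sk; rewrite [#|S|](cardsD1 m) mS.
rewrite /umul -(IH U Uk); case: eqVneq => [->|U0].
  rewrite !arr_sum0 T0 ast0x add0r setD0; apply: eq_arr_sum => v _ vS.
  by apply: (Tcat [::]); apply/allP=> i; rewrite vS => /mtop.
rewrite addr0 [arr_sum U T]/arr_sum (big_morph (ast^~ _) (astDl _) (ast0x _)).
apply: eq_arr_sum => u _ uU.
rewrite /packet_sum [X in ast _ X]/arr_sum (big_morph (ast _) (astDr _) (astx0 _)).
apply: eq_arr_sum => v _ vU; rewrite Tcat.
  by case: u uU => // uU; case/set0Pn: U0 => i; rewrite -uU.
rewrite all_cat; apply/andP; split; apply/allP=> i.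
  by rewrite uU => /(subsetP USm)/mtop.
by rewrite vU => /setDP[/mtop].
Qed.

End Dendriform.

(** * Cut positions and packets of words *)

Section Cuts.
Local Open Scope nat_scope.

Lemma cutsE_cons m v : all (fun x => x < m) v -> cutsE (m :: v) = [::].
Proof.
move=> vm; apply/eqP; rewrite -[_ == _]negbK -has_filter; apply/hasPn=> k.
rewrite mem_iota /= => /andP[]; case: k => // k _ kv; rewrite negb_and -leqNgt ltnW //.
exact: (all_nthP 0 vm).
Qed.

(** The largest letter forces a cut just before it and blocks every later one; earlier tests see
    only letters of [u]. *)
Lemma cutsE_cat u m v :
    u != [::] -> all (fun x => x < m) (u ++ v) ->
  cutsE (u ++ m :: v) = rcons (cutsE u) (size u).
Proof.
rewrite all_cat => u0 /andP[um vm].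
have su : 0 < size u by rewrite lt0n size_eq0.
rewrite /cutsE size_cat /= addnS /= -[in iota _ (_ + _)](prednK su).
rewrite addSnnS iotaD filter_cat /= add1n prednK //.
rewrite take_size_cat // nth_cat ltnn subnn um -cat_rcons -[RHS]cats0.
congr (_ ++ _).
  congr (rcons _ _); apply: eq_in_filter => k; rewrite mem_iota add1n prednK //.
  by case/andP=> _ ku; rewrite take_cat nth_cat ku.
apply/eqP; rewrite -[_ == _]negbK -has_filter; apply/hasPn=> k.
rewrite mem_iota => /andP[uk kv]; apply/allPn; exists m.
  rewrite take_cat ltnNge (ltnW uk) /= mem_cat.
  by rewrite -(subnSK uk) /= mem_head orbT.
rewrite nth_cat [k < _]ltnNge (ltnW uk) /= -(subnSK uk) /= -leqNgt ltnW //.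
by apply: (all_nthP 0 vm); rewrite -(ltn_add2l (size u).+1) subnKC.
Qed.

(** At each of these cuts the preceding letter lies in [u], and the smaller [m] still follows. *)
Lemma no_cutsF u m v : all (fun x => m < x) u ->
  [seq l <- iota 1 (size u) | all (fun x => nth 0 (u ++ m :: v) l.-1 < x)
                                  (drop l (u ++ m :: v))] = [::].
Proof.
move=> um; apply/eqP; rewrite -[_ == _]negbK -has_filter; apply/hasPn=> k.
rewrite mem_iota; case: k => // k; rewrite add1n => /= /ltnSE ku.
apply/allPn; exists m.
  rewrite drop_cat; case: ltnP => [_|uk]; first by rewrite mem_cat mem_head orbT.
  have -> : k.+1 = size u by apply/eqP; rewrite eqn_leq ku.
  by rewrite subnn mem_head.
rewrite nth_cat ku -leqNgt ltnW //; exact: (all_nthP 0 um).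
Qed.

Lemma cutsF_rcons u m : all (fun x => m < x) u -> cutsF (rcons u m) = [::].
Proof. by rewrite /cutsF size_rcons -cats1; apply: no_cutsF. Qed.

(** The smallest letter closes the first packet. Tests past it see only letters of [v], at positions
    shifted by [(size u).+1]. *)
Lemma cutsF_cat u m v :
    v != [::] -> all (fun x => m < x) (u ++ v) ->
  cutsF (rcons u m ++ v) = (size u).+1 :: map (addn (size u).+1) (cutsF v).
Proof.
rewrite all_cat => v0 /andP[um vm].
have sv : 0 < size v by rewrite lt0n size_eq0.
rewrite /cutsF size_cat size_rcons /= -[in iota _ _](prednK sv).
rewrite iotaD filter_cat add1n /= drop_size_cat ?size_rcons //.
rewrite cat_rcons nth_cat ltnn subnn /= vm no_cutsF //=.
rewrite -[(size u).+2]addn1 iotaDl filter_map; congr (_ :: map _ _).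
apply: eq_in_filter => -[|k]; rewrite mem_iota //= => _.
rewrite addnS /= nth_cat ltnNge leqW ?leq_addr //=.
by rewrite addSnnS [size u + _.+2]addnC -drop_drop drop_size_cat // -addnS addKn.
Qed.

Lemma packets_nil T (x : T) s : packets [::] (x :: s) = [:: x :: s].
Proof. by rewrite /packets /= take_size. Qed.

(** A telescoping sum; monotonicity keeps the truncated subtractions exact. *)
Lemma sumn_pairmap_subn k c :
  path leq k c -> sumn (pairmap (fun k l => l - k) k c) + k = last k c.
Proof.
elim: c k => //= l c IH k /andP[kl lc].
by rewrite addnAC subnK // addnC IH.
Qed.

Lemma pairmap_rcons (T1 T2 : Type) (f : T1 -> T1 -> T2) x s y :
  pairmap f x (rcons s y) = rcons (pairmap f x s) (f (last x s) y).
Proof. by elim: s x => //= z s IH x; rewrite IH. Qed.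

Lemma packets_rcons T c (u p : seq T) : path leq 0 (rcons c (size u)) ->
  packets (rcons c (size u)) (u ++ p) = rcons (packets c u) p.
Proof.
move=> /sumn_pairmap_subn; rewrite addn0 last_rcons => sc.
rewrite /packets size_cat [pairmap _ _ (rcons _ (_ + _))]pairmap_rcons.
rewrite last_rcons addKn.
by rewrite reshape_rcons ?sc ?size_cat // take_size_cat // drop_size_cat.
Qed.

Lemma packets_cons T c (p v : seq T) :
  packets (size p :: map (addn (size p)) c) (p ++ v) = p :: packets c v.
Proof.
rewrite /packets /= subn0 take_size_cat // drop_size_cat // size_cat.
rewrite -map_rcons; congr (_ :: reshape _ _).
move: (rcons c _) => s; rewrite -[X in pairmap _ X](addn0 (size p)).
by elim: s 0 => //= l s IH k; rewrite subnDl IH.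
Qed.

Lemma path_cutsE u : path leq 0 (rcons (cutsE u) (size u)).
Proof.
rewrite rcons_path (subseq_path leq_trans (filter_subseq _ _)) /=; last first.
  exact: (iota_sorted 0 (size u).-1.+1).
have: all (fun k => k <= size u) (0 :: cutsE u).
  apply/allP=> k; rewrite inE => /predU1P[-> //|].
  rewrite mem_filter mem_iota add1n => /and3P[_ _ /ltnSE/leq_trans]; apply.
  exact: leq_pred.
by move/allP; apply; apply: mem_last.
Qed.

Lemma packets_neq0 T c (s : seq T) : packets c s <> [::].
Proof.
by rewrite /packets => /(congr1 size); case: c.
Qed.

End Cuts.

(** * Nested products, and permutations as words *)

Lemma nestl_rcons (A : nmodType) (op : A -> A -> A) s x : s != [::] ->
  nestl op (rcons s x) = op (nestl op s) x.
Proof. by case: s => // y s _; rewrite /= foldl_rcons. Qed.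

Lemma nestl_cons (A : nmodType) (op : A -> A -> A) x s : associative op ->
  s != [::] -> nestl op (x :: s) = op x (nestl op s).
Proof.
case: s => // y s opA _ /=.
by elim: s y => //= z s IH y; rewrite -opA IH.
Qed.

Lemma nestr_rcons (A : nmodType) (op : A -> A -> A) s x :
  nestr op (rcons s x) = foldr op x s.
Proof. by elim: s => //= y s <-; case: s. Qed.

Lemma nestr_rev (A : nmodType) (op : A -> A -> A) s :
  nestr op (rev s) = nestl (fun a b => op b a) s.
Proof.
case: s => // x s; rewrite rev_cons nestr_rcons /=.
by rewrite -[s in RHS]revK foldl_rev.
Qed.

Lemma sum_perm_words (A : zmodType) n (f : seq 'I_n -> A) :
  \sum_(s : 'S_n) f [seq s i | i : 'I_n] = arr_sum [set: 'I_n] f.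
Proof.
rewrite /arr_sum -[LHS](big_map (fun s : 'S_n => [seq s i | i : 'I_n]) xpredT).
apply: perm_big; apply: uniq_perm; last 1 first.
- move=> w; rewrite mem_arr; apply/mapP/andP=> [[s _ ->]|[uw /forallP wI]].
    split; first by rewrite map_inj_uniq ?enum_uniq //; apply: perm_inj.
    apply/forallP=> i; rewrite inE; apply/eqP/mapP.
    by exists (s^-1%g i); rewrite ?mem_enum ?permKV.
  have sw : size w = n.
    rewrite -(card_uniqP uw) -[RHS]card_ord; apply: eq_card => i.
    by rewrite (eqP (wI i)) !inE.
  (* A duplicate-free word of length [n], read as a function of the position, is the required
     permutation. *)
  have winj : injective (tnth (tcast sw (in_tuple w))).
    by apply/tuple_uniqP; rewrite val_tcast.
  exists (perm winj); first by rewrite mem_index_enum.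
  transitivity (map (tnth (tcast sw (in_tuple w))) (enum 'I_n)).
    by rewrite map_tnth_enum val_tcast.
  exact/esym/(eq_map (permE winj)).
- rewrite map_inj_uniq ?index_enum_uniq // => s t st; apply/permP=> i.
  by move/eq_in_map: st; apply; rewrite mem_enum.
- exact: permutations_uniq.
Qed.

(** * Packet products split at an extremal letter *)

Section PacketProducts.

Variables (A : nmodType) (ast tri : A -> A -> A) (n : nat) (X : 'I_n -> A).
Implicit Types (m : 'I_n) (u v w : seq 'I_n).

Definition packetsE_prod w : A :=
  nestl ast [seq nestl tri p | p <- packets (cutsE (map val w)) (map X w)].

Definition packetsF_prod w : A :=
  nestl ast [seq nestr tri p | p <- packets (cutsF (map val w)) (map X w)].

Lemma packetsE_prod_cat u m v :
    all (fun i : 'I_n => i < m)%N (u ++ v) ->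
  packetsE_prod (u ++ m :: v)
  = if u == [::] then foldl tri (X m) (map X v)
    else ast (packetsE_prod u) (foldl tri (X m) (map X v)).
Proof.
have uvE : all (fun i : 'I_n => i < m)%N (u ++ v)
           = all (fun x => x < val m)%N (map val u ++ map val v).
  by rewrite -map_cat all_map.
rewrite uvE /packetsE_prod !map_cat /=; case: u {uvE} => [|i u] um.
  by rewrite cutsE_cons // packets_nil.
rewrite cutsE_cat // size_map -(size_map X) packets_rcons; last first.
  by rewrite size_map -(size_map val) path_cutsE.
rewrite map_rcons nestl_rcons //.
by case: packets (@packets_neq0 _ (cutsE (map val (i :: u))) (map X (i :: u))).
Qed.

(** Here the first packet is split off, against the left bracketing of [nestl]; hence the
    associativity of [ast]. *)
Lemma packetsF_prod_cat u m v : associative ast ->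
    all (fun i : 'I_n => m < i)%N (u ++ v) ->
  packetsF_prod (rcons u m ++ v)
  = if v == [::] then foldr tri (X m) (map X u)
    else ast (foldr tri (X m) (map X u)) (packetsF_prod v).
Proof.
move=> astA.
have uvE : all (fun i : 'I_n => m < i)%N (u ++ v)
           = all (fun x => val m < x)%N (map val u ++ map val v).
  by rewrite -map_cat all_map.
rewrite uvE /packetsF_prod !map_cat !map_rcons; case: v {uvE} => [|i v] um.
  rewrite !cats0; have -> : cutsF (rcons (map val u) (val m)) = [::].
    by apply: cutsF_rcons; rewrite cats0 in um.
  have -> : packets [::] (rcons (map X u) (X m)) = [:: rcons (map X u) (X m)].
    by case: (map X u) => *; apply: packets_nil.
  by rewrite /= nestr_rcons.
rewrite cutsF_cat // size_map -(size_map X) -(size_rcons _ (X m)) packets_cons.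
rewrite [map _ (_ :: _)]/= nestr_rcons nestl_cons //.
by case: packets (@packets_neq0 _ (cutsF (map val (i :: v))) (map X (i :: v))).
Qed.

End PacketProducts.

Theorem theorem7p1 (K : fieldType) (char0 : [pchar K] =i pred0)
    (A : lmodType K) (mul : {bilinear A -> A -> A}) (mulA : associative mul)
    (theta : K) (R : {linear A -> A}) (RB : rota_baxter mul theta R)
    (n : nat) (n_gt0 : (0 < n)%N) (X : 'I_n -> A) :
  \sum_(s : 'S_n) spitzer_left mul R s X
    = \sum_(s : 'S_n) R (T_ mul theta R s X)
  /\
  \sum_(s : 'S_n) spitzer_right mul R s X
    = \sum_(s : 'S_n) R (U_ mul theta R s X).
Proof.
have mulDl b : {morph mul^~ b : x y / x + y} by move=> x y; rewrite linearDl.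
have mulDr a : {morph mul a : x y / x + y} by move=> x y; rewrite linearD.
have lettersE (s : 'S_n) : letters X s = map X [seq s i | i : 'I_n].
  exact: map_comp.
have wordE (s : 'S_n) : word s = map val [seq s i | i : 'I_n].
  exact: map_comp.
(* By [RB], [R] turns [rb_ast] into [mul], so both bracketings expand to the same seven terms. *)
have astA : associative (rb_ast mul theta R).
  move=> a b c; rewrite /rb_ast -!RB !(mulDl, mulDr, scalerDr).
  rewrite !linearZl_LR !linearZr_LR !mulA !addrA.
  by rewrite [RHS](ACl (1*2*5*3*6*4*7)).
split; rewrite /spitzer_left /spitzer_right -!linear_sum; congr (R _).
- transitivity (left_sum (fun a b => mul (R a) b) X [set: 'I_n]).
    rewrite /left_sum -sum_perm_words.
    by apply: eq_bigr => s _; rewrite lettersE.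
  rewrite -(@arr_sum_packets _ _ _ (fun a b => mul a (R b) + theta *: mul a b)
    (rb_ast mul theta R) (rb_tright mul theta R) _ _ _ _ _ _ _ _ X
    (fun i m : 'I_n => (i < m)%N)
    (packetsE_prod (rb_ast mul theta R) (rb_tright mul theta R) X)) //.
  + rewrite -sum_perm_words.
    by apply: eq_bigr => s _; rewrite /T_ lettersE wordE.
  + by move=> b x y; rewrite linearD mulDl.
  + by move=> b x y; rewrite !mulDl scalerDr addrACA.
  + by move=> a x y; rewrite linearD !mulDr scalerDr addrACA.
  + by move=> a b; rewrite /rb_ast addrA.
  + by move=> a b; rewrite /rb_tright opprD addrA.
  + by move=> a b c; rewrite /rb_ast mulA RB.
  + by move=> a b c; rewrite mulDr linearZr_LR !mulA.
  + exact: packetsE_prod_cat.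
  move=> S /set0Pn[i0 i0S].
  case: (arg_maxnP (fun i : 'I_n => i : nat) i0S) => m mS max.
  exists m => // i /setD1P[im /max]; rewrite /= ltn_neqAle => ->.
  by rewrite andbT.
- transitivity (left_sum (fun a b => mul b (R a)) X [set: 'I_n]).
    rewrite /left_sum; under eq_bigr => s _ do rewrite lettersE.
    rewrite (sum_perm_words (fun w => nestr _ (map X w))) arr_sum_rev.
    by apply: eq_arr_sum => w _ _; rewrite /= map_rev nestr_rev.
  (* Every operation has its arguments swapped, words are read backwards, and the order on letters
     is reversed. *)
  rewrite -(@arr_sum_packets _ _ _ (fun a b => mul (R b) a + theta *: mul b a)
    (fun a b => rb_ast mul theta R b a) (fun a b => rb_tleft mul theta R b a)
    _ _ _ _ _ _ _ _ X (fun i m : 'I_n => (m < i)%N)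
    (packetsF_prod (rb_ast mul theta R) (rb_tleft mul theta R) X \o rev)) //.
  + rewrite -arr_sum_rev -sum_perm_words.
    by apply: eq_bigr => s _; rewrite /U_ lettersE wordE.
  + by move=> a x y; rewrite linearD mulDr.
  + by move=> b x y; rewrite !mulDr scalerDr addrACA.
  + by move=> a x y; rewrite linearD !mulDl scalerDr addrACA.
  + by move=> a b; rewrite /rb_ast addrCA addrA.
  + by move=> a b; rewrite /rb_tleft opprD addrA.
  + by move=> a b c; rewrite /rb_ast -mulA RB.
  + by move=> a b c; rewrite mulDl linearZl_LR !mulA.
  (* Reversal turns [u ++ m :: v] into [rcons (rev v) m ++ rev u], where [m] closes the first
     packet. *)
  + move=> u m v uv; rewrite /= rev_cat rev_cons packetsF_prod_cat //.
      by rewrite -size_eq0 size_rev size_eq0 map_rev -foldl_rev revK.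
    by rewrite -rev_cat all_rev.
  move=> S /set0Pn[i0 i0S].
  case: (arg_minnP (fun i : 'I_n => i : nat) i0S) => m mS min.
  exists m => // i /setD1P[im /min]; rewrite /= ltn_neqAle => ->.
  by rewrite eq_sym andbT.
Qed.
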